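(* Let $Y=XB^*+C^*+\mathcal E$, where $X\in\mathbb R^{n\times p}$, $B^*\in\mathbb R^{p\times m}$, $C^*\in\mathbb R^{n\times m}$, and $\mathcal E\in\mathbb R^{n\times m}$ has independently and identically distributed $N(0,\sigma^2)$ entries; let $q=\mathrm{rank}(X)$. Assume that $n\ge2$, $1\le J\le n/2$, $1\le r\le q\wedge m$, $r(q+m-r)\ge8$, and that $\sigma_{\min}(X)/\sigma_{\max}(X)$ is a positive constant (i.e. bounded below by a fixed positive constant), where $\sigma_{\max}(X)$ and $\sigma_{\min}(X)$ denote the largest and the smallest nonzero singular values of $X$, respectively. Let $\ell(\cdot)$ be a nondecreasing loss function with $\ell(0)=0$, $\ell\not\equiv0$. Then there exist positive constants $\tilde c,c$, depending on $\ell(\cdot)$ only, such that $$\inf_{(\hat B,\hat C)}\ \sup_{(B^*,C^* )\in\mathcal S(r,J)}E\big(\ell[M(\hat B-B^*,\hat C-C^* )/\{\tilde c\,P_o(J,r)\}]\big)\ \ge\ c>0,$$ where $(\hat B,\hat C)$ denotes any estimator of $(B^*,C^* )$ and $$P_o(J,r)=\sigma^2\{r(q+m)+Jm+J\log(en/J)\}.$$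
   Context: $\mathcal S(r,J)=\{(B^*,C^* ):\mathrm{rank}(B^* )\le r,\ J(C^* )\le J\}$, where $J(C)=\|C\|_{2,0}$ is the number of nonzero rows of $C$. $M(B,C)=\|XB+C\|_F^2$, with $\|\cdot\|_F$ the Frobenius norm. $\ell$ is defined on $[0,\infty)$; $a\wedge b=\min(a,b)$; $e$ is the Euler constant (base of natural logarithms). An estimator is a (measurable) function of the observed data $(X,Y)$, with $X$ non-random. *)

(* Defs.v *)
From HB Require Import structures.
From mathcomp Require Import all_boot all_order all_algebra.
From mathcomp Require Import all_classical all_reals all_analysis.
Set Implicit Arguments.
Unset Strict Implicit.
Unset Printing Implicit Defensive.
Import Order.TTheory GRing.Theory Num.Theory.
Import numFieldNormedType.Exports.
Local Open Scope classical_set_scope.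
Local Open Scope ring_scope.

Definition frobenius (R : realType) (a b : nat) (A : 'M[R]_(a, b)) : R :=
  Num.sqrt (\sum_i \sum_j A i j ^+ 2).

Definition row_sparsity (R : realType) (a b : nat) (C : 'M[R]_(a, b)) : nat :=
  #|[set i : 'I_a | row i C != 0]|%SET.

Definition singular_value (R : realType) (a b : nat) (X : 'M[R]_(a, b)) :
    set R :=
  [set s | 0 <= s /\ eigenvalue (X^T *m X) (s ^+ 2)].

(* The set of nonzero singular values is finite, and nonempty when X != 0, so
   for X != 0 the sup and inf below are attained: they are the largest and the
   smallest nonzero singular values. *)
Definition sigma_max (R : realType) (a b : nat) (X : 'M[R]_(a, b)) : R :=
  sup [set s | singular_value X s /\ s != 0].

Definition sigma_min (R : realType) (a b : nat) (X : 'M[R]_(a, b)) : R :=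
  inf [set s | singular_value X s /\ s != 0].

Definition loss (R : realType) (n p m : nat) (X : 'M[R]_(n, p))
    (B : 'M[R]_(p, m)) (C : 'M[R]_(n, m)) : R :=
  frobenius (X *m B + C) ^+ 2.

Definition param_space (R : realType) (n p m r J : nat) :
    set ('M[R]_(p, m) * 'M[R]_(n, m)) :=
  [set BC | (\rank BC.1 <= r)%N /\ (row_sparsity BC.2 <= J)%N].

Definition P_o (R : realType) (sigma : R) (n m q J r : nat) : R :=
  sigma ^+ 2 * ((r * (q + m))%:R + (J * m)%:R
                + J%:R * ln (expR 1 * n%:R / J%:R)).

(* Matrices with the product of the Borel sigma-algebras of the entries, which
   is the Borel sigma-algebra of R^(a x b). *)
Definition mx_cylinder (R : realType) (a b : nat) : set (set 'M[R]_(a, b)) :=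
  [set U | exists i j (V : set R),
     measurable V /\ U = (fun A : 'M[R]_(a, b) => A i j) @^-1` V].

Definition borel_mx (R : realType) (a b : nat) :=
  g_sigma_algebraType (@mx_cylinder R a b).

Definition estimator (R : realType) (n p m : nat) :
    set (('M[R]_(n, m) -> 'M[R]_(p, m)) * ('M[R]_(n, m) -> 'M[R]_(n, m))) :=
  [set D | measurable_fun [set: borel_mx R n m]
             (D.1 : borel_mx R n m -> borel_mx R p m) /\
           measurable_fun [set: borel_mx R n m]
             (D.2 : borel_mx R n m -> borel_mx R n m)].

Definition mutually_independent (R : realType) (d : measure_display)
    (T : measurableType d) (P : probability T R) (I : finType)
    (X : I -> {RV P >-> R}) : Prop :=
  forall (S : {set I}) (A : I -> set R), (forall i, measurable (A i)) ->
    P (\bigcap_(i in [set` S]) (X i @^-1` A i)) =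
    (\prod_(i in S) P (X i @^-1` A i))%E.

Definition gaussian_noise (R : realType) (d : measure_display)
    (T : measurableType d) (P : probability T R) (n m : nat) (sigma : R)
    (E : 'I_n * 'I_m -> {RV P >-> R}) : Prop :=
  mutually_independent E /\
  forall k (A : set R), measurable A ->
    distribution P (E k) A = normal_prob 0 sigma A.

Definition observation (R : realType) (d : measure_display)
    (T : measurableType d) (P : probability T R) (n p m : nat)
    (X : 'M[R]_(n, p)) (E : 'I_n * 'I_m -> {RV P >-> R})
    (B : 'M[R]_(p, m)) (C : 'M[R]_(n, m)) (w : T) : 'M[R]_(n, m) :=
  X *m B + C + \matrix_(i, j) E (i, j) w.

Definition risk (R : realType) (d : measure_display) (T : measurableType d)
    (P : probability T R) (n p m : nat) (X : 'M[R]_(n, p))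
    (E : 'I_n * 'I_m -> {RV P >-> R}) (ell : R -> R) (scale : R)
    (D : ('M[R]_(n, m) -> 'M[R]_(p, m)) * ('M[R]_(n, m) -> 'M[R]_(n, m)))
    (BC : 'M[R]_(p, m) * 'M[R]_(n, m)) : \bar R :=
  ('E_P[fun w => let Y := observation X E BC.1 BC.2 w in
          ell (loss X (D.1 Y - BC.1) (D.2 Y - BC.2) / scale)%R])%E.

(* Main.v *)
(** The risk dominates [ell t] times the probability that the loss exceeds [t]
    times the scale, so it suffices to bound the loss from below with constant
    probability at one point of a finite subfamily of the parameter space.

    All subfamilies are products of [K] independent [b]-ary testing problems:
    means [delta * \sum_k v k (theta k)] with [v k j] orthogonal across
    different [k], of norm at most 1, and at distance at least 1 for different
    [j].  By a Gaussian change of measure and AM-GM, a test of one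
    coordinate is correct with average probability at most
    [exp (delta^2 / (2 sigma^2)) / sqrt b], which for
    [delta^2 = sigma^2 (ln b) / 2] is [b^(-1/4) < 6/7].  Decoding an estimator
    to the nearest mean, a constant fraction of the coordinates is then wrong
    with constant probability (Assouad's argument), whence a loss of order
    [sigma^2 K ln b].

    With [X W] an orthonormal system in the column space of [X], four choices
    cover the terms of [P_o]: [q r] bits in the coefficients of [X W] on the
    first [r] columns, [r m] bits in the coefficients of [r] such vectors,
    [J m] bits in the first [J] rows of [C], and in one column of [C] one spike
    in each of [J] blocks of [n / J] rows. *)
Require Import Defs.
From HB Require Import structures.
From mathcomp Require Import all_boot all_order all_algebra.
From mathcomp Require Import all_classical all_reals all_analysis.
From mathcomp Require Import measurable_realfun ring lra zify.
Set Implicit Arguments.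
Unset Strict Implicit.
Unset Printing Implicit Defensive.
Import Order.TTheory GRing.Theory Num.Theory.
Import numFieldNormedType.Exports.
Local Open Scope classical_set_scope.
Local Open Scope ring_scope.

(** * Densities and products of independent variables *)

Section density.
Local Open Scope ereal_scope.
Context d1 d2 (T : measurableType d1) (U : measurableType d2) (R : realType).
Variables (mu : {measure set T -> \bar R}) (nu : {measure set U -> \bar R}).
Variables (X : T -> U) (W : T -> R) (C : \bar R).
Hypothesis mX : measurable_fun setT X.
Hypothesis mW : measurable_fun setT W.
Hypothesis W0 : forall x, (0 <= W x)%R.
Hypothesis C0 : C \is a fin_num.
Hypothesis XW : forall B, measurable B ->
  \int[mu]_(x in X @^-1` B) (W x)%:E = C * nu B.

Import HBNNSimple.

(** Hypothesis [XW] says that [X] pushes the measure with density [W] forward to [C] times [nu]. The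
    identity extends from indicators to simple functions by linearity, then by monotone convergence.
    The factor [C] makes room for a weight independent of [X]. *)
Lemma ge0_integral_density (f : U -> R) : measurable_fun setT f ->
    (forall y, (0 <= f y)%R) ->
  \int[mu]_x (f (X x) * W x)%:E = C * \int[nu]_y (f y)%:E.
Proof.
move=> mf f0.
have mEf : measurable_fun [set: U] (fun y => (f y)%:E) by exact/measurable_EFinP.
have mpre B : measurable B -> measurable (X @^-1` B).
  by move=> mB; rewrite -[X in measurable X]setTI; exact: mX.
have simple (h : {nnsfun U >-> R}) :
    \int[mu]_x (h (X x) * W x)%:E = C * \int[nu]_y (h y)%:E.
  under [in RHS]eq_integral do rewrite fimfunE -fsumEFin//.
  rewrite [in RHS]ge0_integral_fsum//; last 2 first.
  - by move=> r; exact/measurable_EFinP/measurableT_comp.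
  - by move=> r y _; rewrite EFinM nnfun_muleindic_ge0.
  rewrite ge0_mule_fsumr; last first.
    by move=> r; apply: integral_ge0 => y _; rewrite EFinM nnfun_muleindic_ge0.
  transitivity (\int[mu]_x (\sum_(r \in range h)
      (r * \1_(h @^-1` [set r]) (X x) * W x)%:E)).
    apply: eq_integral => x _; rewrite fimfunE EFinM -fsumEFin// muleC.
    rewrite ge0_mule_fsumr; last first.
      by move=> r; rewrite EFinM nnfun_muleindic_ge0.
    by apply: eq_fsbigr => r _; rewrite -EFinM mulrC.
  rewrite ge0_integral_fsum//; last 2 first.
  - move=> r; apply/measurable_EFinP; apply: measurable_funM => //.
    by apply: measurable_funM => //; exact: measurableT_comp.
  - move=> r y _; rewrite EFinM mule_ge0 ?lee_fin ?W0//.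
    by rewrite -lee_fin EFinM nnfun_muleindic_ge0.
  apply: eq_fsbigr => r rh.
  rewrite integralZl_indic_nnsfun// integral_indic// setIT.
  have r0 : (0 <= r)%R by move: rh; rewrite inE => -[y _ <-].
  under eq_integral do rewrite -mulrA EFinM.
  rewrite ge0_integralZl//; last 2 first.
  - apply/measurable_EFinP/measurable_funM => //.
    exact: measurableT_comp.
  - by move=> x _; rewrite lee_fin mulr_ge0 ?W0// indicE ler0n.
  rewrite muleCA; congr (_ * _).
  rewrite -XW// [RHS]integral_mkcond; apply: eq_integral => x _.
  rewrite /patch indicE/=; case: ifPn => xr.
    by rewrite (_ : X x \in _) ?mul1r//; move: xr; rewrite !inE.
  rewrite (_ : X x \in _ = false) ?mul0r//.
  by apply/negbTE; apply: contra xr; rewrite !inE.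
pose f_ := nnsfun_approx measurableT mEf.
have fcvg y : EFin \o f_^~ y @ \oo --> (f y)%:E.
  by apply: cvg_nnsfun_approx => //= z _; rewrite lee_fin.
transitivity (limn (fun n => \int[mu]_x (f_ n (X x) * W x)%:E)).
  rewrite -monotone_convergence//.
  - apply: eq_integral => x _; apply/esym/cvg_lim => //.
    rewrite [X in X @ _](_ : _ = fun n => (f_ n (X x))%:E * (W x)%:E).
      rewrite EFinM; apply: cvgeZr => //; exact: fcvg.
    by [].
  - move=> n; apply/measurable_EFinP/measurable_funM => //.
    exact: measurableT_comp.
  - by move=> n x _; rewrite lee_fin mulr_ge0 ?W0//.
  - move=> x _ m n mn; rewrite lee_fin ler_wpM2r ?W0//.
    exact/lefP/nd_nnsfun_approx.
under eq_fun do rewrite simple.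
rewrite limeMl//; last first.
  apply: ereal_nondecreasing_is_cvgn => m n mn; apply: ge0_le_integral => //.
  - by move=> y _; rewrite lee_fin.
  - exact/measurable_EFinP.
  - exact/measurable_EFinP.
  - by move=> y _; rewrite lee_fin; exact/lefP/nd_nnsfun_approx.
congr (_ * _); rewrite -monotone_convergence//.
- by apply: eq_integral => y _; apply/cvg_lim => //; exact: fcvg.
- by move=> n; exact/measurable_EFinP.
- by move=> n y _; rewrite lee_fin.
- by move=> y _ m n mn; rewrite lee_fin; exact/lefP/nd_nnsfun_approx.
Qed.
End density.

Section independence.
Local Open Scope ereal_scope.
Context (R : realType) (d : measure_display) (T : measurableType d)
  (P : probability T R) (I : finType) (X : I -> {RV P >-> R}).
Hypothesis indX : mutually_independent X.

Lemma integral_indicRV (k : I) (A : set R) : measurable A ->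
  \int[P]_w (\1_A (X k w))%:E = P (X k @^-1` A).
Proof.
move=> mA.
have mX : measurable (X k @^-1` A).
  by rewrite -[Y in measurable Y]setTI; exact: measurable_funP.
transitivity (\int[P]_w (\1_(X k @^-1` A) w)%:E).
  by apply: eq_integral => w _; rewrite !indicE.
by rewrite integral_indic// setIT.
Qed.

(** Mutual independence is the case of indicators; factors are released one at a time from
    indicators to arbitrary functions. *)
Lemma ge0_integral_prod_indep (f : I -> R -> R) :
    (forall i, measurable_fun setT (f i)) -> (forall i x, (0 <= f i x)%R) ->
    (forall i, \int[P]_w (f i (X i w))%:E \is a fin_num) ->
  \int[P]_w (\prod_i f i (X i w))%:E = \prod_i \int[P]_w (f i (X i w))%:E.
Proof.
have mX k A : measurable A -> measurable (X k @^-1` A).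
  by move=> mA; rewrite -[Y in measurable Y]setTI; exact: measurable_funP.
(* Induction on the list [s] of indices whose factor is arbitrary; every factor outside [s] is an
   indicator. *)
suff H : forall s : seq I, forall f : I -> R -> R,
    (forall i, measurable_fun setT (f i)) -> (forall i x, (0 <= f i x)%R) ->
    (forall i, \int[P]_w (f i (X i w))%:E \is a fin_num) ->
    (forall i, i \notin s -> exists2 A, measurable A & f i = \1_A) ->
    \int[P]_w (\prod_i f i (X i w))%:E = \prod_i \int[P]_w (f i (X i w))%:E.
  move=> mf f0 ff; apply: (H (enum I)) => // i.
  by rewrite mem_enum.
elim=> [|k s IH] {}f mf f0 ff fA.
  have /choice[A fAE] : forall i, exists A, measurable A /\ f i = \1_A.
    by move=> i; have [//|A mA fi] := fA i; exists A.
  have mA i : measurable (A i) by have [] := fAE i.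
  pose B := \bigcap_(i in [set` finset.setTfor I]) (X i @^-1` A i).
  transitivity (\int[P]_w (\1_B w)%:E).
    apply: eq_integral => w _; congr (_%:E); rewrite indicE.
    have -> : (\prod_i f i (X i w) = \prod_i (X i w \in A i)%:R :> R)%R.
      by apply: eq_bigr => i _; rewrite (fAE i).2 indicE.
    case: (pselect (forall i, A i (X i w))) => [wA|].
      rewrite mem_set; last by move=> i _; exact: wA.
      by rewrite [LHS]big1// => i _; rewrite mem_set//; exact: wA.
    move/existsNP => [i iA]; rewrite memNset; last first.
      by move=> /(_ i); apply: contra_not iA; apply => /=; rewrite inE.
    by rewrite (bigD1 i)//= memNset// mul0r.
  have mB : measurable B by apply: fin_bigcap_measurable => // i _; exact: mX.
  rewrite integral_indic// setIT.
  apply: (eq_trans (indX (finset.setTfor I) mA)); apply: eq_big => [i|i _]; first by rewrite inE.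
  by rewrite (fAE i).2 integral_indicRV.
have mW : measurable_fun setT (fun w => (\prod_(i | i != k) f i (X i w))%R).
  under eq_fun do rewrite -big_filter.
  by apply: measurable_prod => i _; exact: measurableT_comp.
rewrite [RHS](bigD1 k)//= muleC.
transitivity (\int[P]_w (f k (X k w) * \prod_(i | i != k) f i (X i w))%:E).
  by apply: eq_integral => w _; rewrite (bigD1 k).
(* Factor [k] is integrated against the law of [X k], the product of the other factors being the
   weight. The identity required on sets is the induction hypothesis for [g] below, whose factor [k]
   is an indicator. *)
rewrite (@ge0_integral_density _ _ _ _ _ P (distribution P (X k)) (X k) _
    (\prod_(i | i != k) \int[P]_w (f i (X i w))%:E))//.
- rewrite (@ge0_integral_distribution _ _ _ _ _ P (X k) (EFin \o f k))//.
    exact/measurable_EFinP.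
  by move=> x; rewrite lee_fin.
- by move=> w; apply: prodr_ge0 => i _; exact: f0.
- apply: prode_fin_num => i _; exact: ff.
move=> B mB; pose g i := if i == k then \1_B : R -> R else f i.
have gE i : i != k -> g i = f i by rewrite /g => /negbTE ->.
have gk : g k = \1_B by rewrite /g eqxx.
transitivity (\int[P]_w (\prod_i g i (X i w))%:E).
  rewrite integral_mkcond; apply: eq_integral => w _.
  rewrite (bigD1 k)//= gk /patch indicE.
  under [in RHS]eq_bigr => i ik do rewrite gE//.
  have [wB|wB] := pselect (B (X k w)); first by rewrite !mem_set// mul1r.
  by rewrite !memNset// mul0r.
rewrite IH.
- rewrite (bigD1 k)//= gk integral_indicRV// muleC; congr (_ * _).
  by apply: eq_bigr => i ik; rewrite gE.
- by move=> i; rewrite /g; case: ifP => // _; exact: measurable_indic.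
- by move=> i x; rewrite /g; case: ifP => // _; rewrite indicE ler0n.
- move=> i; have [->|/gE->//] := eqVneq i k.
  by rewrite gk integral_indicRV// fin_num_measure//; exact: mX.
move=> i iS; have [->|ik] := eqVneq i k; first by rewrite gk; exists B.
by rewrite gE//; apply: fA; rewrite inE negb_or ik.
Qed.

End independence.

(** * Gaussian change of measure *)

(** The likelihood ratio of N(h, s^2) to N(0, s^2) at [x]. *)
Definition gauss_tilt (R : realType) (s h x : R) : R :=
  expR ((h * x - h ^+ 2 / 2) / s ^+ 2).

Lemma measurable_gauss_tilt (R : realType) (s h : R) :
  measurable_fun setT (gauss_tilt s h).
Proof.
apply: measurableT_comp => //; apply: measurable_funM => //.
by apply: measurable_funB => //; exact: measurable_funM.
Qed.

(** Makes the second moment of the likelihood ratio explicit, since the tilt by [2 h] has mean 1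
    under N(0, s^2). *)
Lemma gauss_tilt_sqr (R : realType) (s h x : R) :
  gauss_tilt s h x ^+ 2 = expR (h ^+ 2 / s ^+ 2) * gauss_tilt s (h *+ 2) x.
Proof.
rewrite /gauss_tilt -expRD -expRM_natl; congr expR.
by set c := (s ^+ 2)^-1; field.
Qed.

Section normal_shift.
Local Open Scope ereal_scope.
Context (R : realType) (s : R).
Hypothesis s0 : (s != 0)%R.

(** The density of N(0, s^2) times the tilt is that of N(h, s^2). Asking [nu] only to agree with the
    normal law on measurable sets covers the law of a noise entry. *)
Lemma integral_gauss_tilt (nu : {measure set R -> \bar R}) (h : R) (A : set R) :
    (forall B, measurable B -> nu B = normal_prob 0 s B) -> measurable A ->
  \int[nu]_x (\1_A x * gauss_tilt s h x)%:E = normal_prob h s A.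
Proof.
move=> nuE mA.
have := @ge0_integral_density _ _ (measurableTypeR R) R R (@lebesgue_measure R)
  nu id (normal_pdf 0 s) 1%E.
move=> /(_ _ (measurable_normal_pdf 0 s) (normal_pdf_ge0 0 s)).
move=> /(_ _ _ _ (fun x => \1_A x * gauss_tilt s h x)%R).
rewrite mul1e => <-//.
- rewrite /normal_prob [RHS]integral_mkcond; apply: eq_integral => x _.
  rewrite /patch indicE; case: ifPn => _; last by rewrite !mul0r.
  rewrite mul1r /normal_pdf !(negbTE s0) mulrCA; congr (_%:E).
  rewrite /normal_fun /gauss_tilt -expRD; congr (_ * expR _)%R.
  by field.
- by move=> B mB; rewrite mul1e nuE.
- by apply: measurable_funM => //; exact: measurable_gauss_tilt.
- by move=> x; rewrite mulr_ge0 ?expR_ge0// indicE ler0n.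
Qed.

(** Lebesgue measure is translation invariant, being determined by its values on intervals, and the
    density of N(h, s^2) is that of N(0, s^2) translated by [h]. *)
Lemma normal_prob_shift (h : R) (A : set R) : measurable A ->
  normal_prob 0 s [set x | A (x + h)%R] = normal_prob h s A.
Proof.
move=> mA; pose t (x : measurableTypeR R) : measurableTypeR R := (x + h)%R.
have mt : measurable_fun setT t by exact: measurable_funD.
have leb B : measurable B ->
    pushforward (@lebesgue_measure R) t B = lebesgue_measure B.
  move=> mB; apply/esym/lebesgue_measure_unique => //= _ [[a b]] _ <-.
  rewrite /pushforward (_ : t @^-1` _ = `](a - h)%R, (b - h)%R]%classic).
    by rewrite !lebesgue_measure_itv/= !lte_fin ltrD2r -!EFinB opprB addrA subrK.
  by apply/seteqP; split => x; rewrite /t/= !in_itv/= ltrBlDr lerBrDr.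
rewrite /normal_prob.
transitivity (\int[pushforward (@lebesgue_measure R) t]_(x in A)
    (normal_pdf h s x)%:E); last first.
  by apply: eq_measure_integral => B mB _; exact: leb.
rewrite ge0_integral_pushforward//.
- by apply: eq_integral => x _; rewrite /= /normal_pdf !(negbTE s0)
    /normal_fun /t subr0 addrK.
- by apply/measurable_EFinP; apply: measurable_funTS; exact: measurable_normal_pdf.
- by move=> x _; rewrite lee_fin normal_pdf_ge0.
Qed.

End normal_shift.

(** * Borel structure on matrices *)

Lemma measurable_entry (R : realType) (a b : nat) (i : 'I_a) (j : 'I_b) :
  measurable_fun [set: borel_mx R a b] (fun M : borel_mx R a b => M i j).
Proof.
move=> _ V mV; rewrite setTI; apply: sub_gen_smallest.
by exists i, j, V.
Qed.

Lemma measurable_mx (R : realType) d (T : measurableType d) (a b : nat)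
    (f : T -> borel_mx R a b) :
  (forall i j, measurable_fun setT (fun w => f w i j)) -> measurable_fun setT f.
Proof.
move=> mf; apply: (@measurability _ _ T (borel_mx R a b) setT f (@mx_cylinder R a b)) => //.
move=> _ [_ [i [j [V [mV ->]]]] <-].
exact: mf.
Qed.

(** The Frobenius inner product. *)
Definition mx_dot (R : realType) (a b : nat) (A B : 'M[R]_(a, b)) : R :=
  \sum_i \sum_j A i j * B i j.

(** Unlike the generating cylinders, rectangles are closed under intersection, as a Dynkin argument
    requires. *)
Definition mx_rectangle (R : realType) (a b : nat) : set (set 'M[R]_(a, b)) :=
  [set U : set 'M[R]_(a, b) | exists2 V : 'I_a * 'I_b -> set R, forall k, measurable (V k) &
     U = [set M : 'M[R]_(a, b) | forall k, V k (M k.1 k.2)]].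

Lemma measurable_mx_rectangle (R : realType) (a b : nat) :
  @measurable _ (borel_mx R a b) = <<s @mx_rectangle R a b >>.
Proof.
apply/seteqP; split; apply: smallest_sub; try exact: smallest_sigma_algebra.
- move=> U [i [j [V [mV ->]]]]; apply: sub_gen_smallest.
  exists (fun k => if k == (i, j) then V else setT).
    by move=> k; case: ifP.
  apply/seteqP; split => [M /= MV k|M /= /(_ (i, j))]; last by rewrite eqxx.
  by case: eqP => [->|].
- move=> U [V mV ->].
  rewrite (_ : [set M | _] = \bigcap_(k in [set: 'I_a * 'I_b])
      ((fun M : borel_mx R a b => M k.1 k.2) @^-1` V k)).
    apply: fin_bigcap_measurable => // k _.
    rewrite -[X in measurable X]setTI; exact: measurable_entry.
  by apply/seteqP; split => [M MV k _|M MV k]; [exact: MV|exact: (MV k)].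
Qed.

Lemma setI_closed_mx_rectangle (R : realType) (a b : nat) :
  setI_closed (@mx_rectangle R a b).
Proof.
move=> _ _ [V mV ->] [W mW ->].
exists (fun k => V k `&` W k); first by move=> k; exact: measurableI.
apply/seteqP; split => [M [MV MW] k|M MVW]; first by split; [exact: MV|exact: MW].
by split=> k; have [] := MVW k.
Qed.

(** * Law of a translated Gaussian matrix *)

Section gaussian_noise.
Local Open Scope ereal_scope.
Context (R : realType) (d : measure_display) (T : measurableType d)
  (P : probability T R) (n m : nat) (s : R) (E : 'I_n * 'I_m -> {RV P >-> R}).
Hypothesis s0 : (s != 0)%R.
Hypothesis gE : gaussian_noise s E.

Definition noise (w : T) : borel_mx R n m := (\matrix_(i, j) E (i, j) w)%R.

(** The density of the law of [H + noise] with respect to that of [noise], evaluated at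
    [noise w]. *)
Definition likelihood (H : 'M[R]_(n, m)) (w : T) : R :=
  (\prod_k gauss_tilt s (H k.1 k.2) (E k w))%R.

Lemma noiseE w (k : 'I_n * 'I_m) : noise w k.1 k.2 = E k w.
Proof. by rewrite mxE -surjective_pairing. Qed.

Lemma measurable_noise : measurable_fun setT noise.
Proof.
apply: measurable_mx => i j; under eq_fun do rewrite mxE.
exact: measurable_funP.
Qed.

Lemma measurable_noise_shift (H : 'M[R]_(n, m)) :
  measurable_fun setT (fun w => (H + noise w)%R : borel_mx R n m).
Proof.
apply: measurable_mx => i j; under eq_fun do rewrite mxE.
apply: measurable_funD => //.
exact: (measurableT_comp (measurable_entry i j) measurable_noise).
Qed.

Lemma likelihood_ge0 H w : (0 <= likelihood H w)%R.
Proof. by apply: prodr_ge0 => k _; exact: expR_ge0. Qed.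

Lemma measurable_likelihood H : measurable_fun setT (likelihood H).
Proof.
apply: measurable_prod => k _; apply: measurableT_comp.
  exact: measurable_gauss_tilt.
exact: measurable_funP.
Qed.

(** Over a rectangle both the indicator and the likelihood factor over the entries, so independence
    reduces the integral to one-dimensional tilts. *)
Lemma integral_likelihood_rectangle (H : 'M[R]_(n, m))
    (V : 'I_n * 'I_m -> set R) : (forall k, measurable (V k)) ->
  \int[P]_(w in noise @^-1` [set M : 'M[R]_(n, m) | forall k, V k (M k.1 k.2)])
    (likelihood H w)%:E = \prod_k normal_prob (H k.1 k.2) s (V k).
Proof.
move=> mV; pose f k (x : R) := (\1_(V k) x * gauss_tilt s (H k.1 k.2) x)%R.
have mf k : measurable_fun setT (f k).
  by apply: measurable_funM => //; exact: measurable_gauss_tilt.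
have f0 k x : (0 <= f k x)%R.
  by rewrite mulr_ge0 ?expR_ge0// indicE ler0n.
have intf k : \int[P]_w (f k (E k w))%:E = normal_prob (H k.1 k.2) s (V k).
  rewrite -(@integral_gauss_tilt _ s s0 (distribution P (E k)))//; last first.
    by move=> B mB; exact: gE.2.
  rewrite (@ge0_integral_distribution _ _ _ _ _ P (E k) (EFin \o f k))//.
    exact/measurable_EFinP.
  by move=> x; rewrite lee_fin.
transitivity (\int[P]_w (\prod_k f k (E k w))%:E).
  rewrite integral_mkcond; apply: eq_integral => w _.
  rewrite /patch/= big_split/=; have [wV|wV] := pselect (forall k, V k (E k w)).
    rewrite mem_set; last by move=> k /=; rewrite noiseE.
    by rewrite big1 ?mul1r// => k _; rewrite indicE mem_set.
  rewrite memNset; last by apply: contra_not wV => + k => /(_ k)/=; rewrite noiseE.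
  move/existsNP: wV => [k kV].
  by rewrite (bigD1 k)//= indicE memNset// !mul0r.
rewrite (ge0_integral_prod_indep gE.1)//; first exact: eq_bigr.
move=> k; rewrite intf; apply: (@fin_num_measure _ _ _ (normal_prob _ s)).
exact: mV.
Qed.

Lemma integral_likelihood (H : 'M[R]_(n, m)) :
  \int[P]_w (likelihood H w)%:E = 1.
Proof.
have := @integral_likelihood_rectangle H (fun=> setT) (fun=> measurableT).
rewrite (_ : noise @^-1` _ = setT); last by apply/seteqP.
by move=> ->; rewrite big1// => k _; exact: probability_setT.
Qed.

(* Cameron-Martin formula for a finite-dimensional Gaussian vector. *)
Lemma noise_shift (H : 'M[R]_(n, m)) (A : set (borel_mx R n m)) :
    measurable A ->
  P [set w | A (H + noise w)%R] =
  \int[P]_(w in noise @^-1` A) (likelihood H w)%:E.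
Proof.
have mN A' : measurable A' -> measurable (noise @^-1` A').
  by move=> mA; rewrite -[X in measurable X]setTI; exact: measurable_noise.
have mNH (A' : set (borel_mx R n m)) : measurable A' -> measurable [set w | A' (H + noise w)%R].
  by move=> mA; rewrite -[X in measurable X]setTI; exact: measurable_noise_shift.
have mL : measurable_fun setT (fun w => (likelihood H w)%:E).
  by apply/measurable_EFinP; exact: measurable_likelihood.
have L0 w : 0 <= (likelihood H w)%:E by rewrite lee_fin likelihood_ge0.
have LT := integral_likelihood H.
rewrite {1}measurable_mx_rectangle => mA.
(* The class of sets satisfying the formula contains the rectangles and is stable under complement,
   both sides having total mass 1, and under countable disjoint unions. *)
pose Q := [set A : set (borel_mx R n m) | P [set w | A (H + noise w)%R] =
  \int[P]_(w in noise @^-1` A) (likelihood H w)%:E].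
apply: (@dynkin_induction _ (borel_mx R n m) (@mx_rectangle R n m) Q) => //.
- exact: measurable_mx_rectangle.
- exact: setI_closed_mx_rectangle.
- rewrite /Q/= preimage_setT LT.
  by rewrite (_ : [set _ | _] = setT) ?probability_setT//; apply/seteqP.
- move=> _ [V mV ->]; rewrite /Q/= integral_likelihood_rectangle//.
  (* Independence splits the shifted event into one event per entry, with sides translated by the
     entries of [H]. *)
  pose V' k := [set x | V k (x + H k.1 k.2)%R].
  have mV' k : measurable (V' k).
    have mt : measurable_fun setT (fun x : R => x + H k.1 k.2)%R.
      exact: measurable_funD.
    by rewrite -[X in measurable X]setTI; exact: mt.
  rewrite (_ : [set w | _] =
      \bigcap_(k in [set` finset.setTfor ('I_n * 'I_m)%type]) (E k @^-1` V' k)).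
    apply: (eq_trans (gE.1 (finset.setTfor ('I_n * 'I_m)%type) V' mV')).
    apply: eq_big => [k|k _]; first by rewrite inE.
    rewrite -normal_prob_shift//.
    exact: gE.2.
  apply/seteqP; split => [w wV k _|w wV k] /=.
    by have := wV k; rewrite /V'/= mxE noiseE addrC.
  have /= := wV k; rewrite /V'/= mxE noiseE addrC; apply.
  by rewrite inE.
- move=> S mS; rewrite /Q/= => QS.
  rewrite (_ : [set w | _] = ~` [set w | S (H + noise w)%R])//.
  rewrite probability_setC; last exact: mNH.
  rewrite QS -LT -(setvU (noise @^-1` S)) ge0_integral_setU//.
  + rewrite addeK// -QS fin_num_measure//; exact: mNH.
  + exact: measurableC (mN _ mS).
  + exact: mN.
  + exact: measurable_funS mL.
  + by rewrite disj_set2E setICl.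
- move=> F mF tF QF; rewrite /Q/=.
  rewrite (_ : [set w | _] = \bigcup_k [set w | F k (H + noise w)%R])//.
  rewrite measure_bigcup//; last 2 first.
  + by move=> k _; exact: mNH.
  + apply/trivIsetP => i j _ _ ij; apply/seteqP; split => // w [/= Fi Fj].
    move/trivIsetP : tF => /(_ i j I I ij)/seteqP[+ _] => /(_ (H + noise w)%R).
    exact.
  rewrite preimage_bigcup ge0_integral_bigcup//.
  + rewrite (eq_eseriesl _ _ (Q := xpredT)); last by move=> k; rewrite in_setT.
    by apply: eq_eseriesr => k _; exact: QF.
  + by move=> k; exact: mN.
  + exact: measurable_funS mL.
  + apply/trivIsetP => i j _ _ ij; apply/seteqP; split => // w [/= Fi Fj].
    move/trivIsetP : tF => /(_ i j I I ij)/seteqP[+ _] => /(_ (noise w)).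
    exact.
Qed.

Lemma likelihood_sqr (H : 'M[R]_(n, m)) w :
  (likelihood H w ^+ 2 =
   expR (mx_dot H H / s ^+ 2) * likelihood (H *+ 2) w)%R.
Proof.
rewrite /likelihood -prodrXl.
under eq_bigr do rewrite gauss_tilt_sqr.
rewrite big_split/= -expR_sum; congr (expR _ * _)%R.
  rewrite -mulr_suml /mx_dot pair_big/=; congr (_ * _)%R.
by apply: eq_bigr => k _; rewrite mulmxnE.
Qed.

(** The likelihood ratio is bounded by a constant, kept on [A], plus a multiple of its square,
    integrated over the whole space. The weight [l] is left free for later tuning. *)
Lemma noise_shift_le (H : 'M[R]_(n, m)) (l : R) (A : set (borel_mx R n m)) :
    (0 < l)%R -> measurable A ->
  P [set w | A (H + noise w)%R] <=
  (l / 2)%:E * P [set w | A (noise w)]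
    + (expR (mx_dot H H / s ^+ 2) / (2 * l))%:E.
Proof.
move=> l0 mA; rewrite noise_shift//.
have mN : measurable (noise @^-1` A).
  by rewrite -[X in measurable X]setTI; exact: measurable_noise.
have mL H' : measurable_fun setT (fun w => (likelihood H' w)%:E).
  by apply/measurable_EFinP; exact: measurable_likelihood.
set M := expR _.
(* AM-GM: [L <= l / 2 + L ^ 2 / (2 * l)] for the likelihood ratio [L], where
   [L ^ 2] is [M] times the likelihood ratio of the shift [2 H]. *)
apply: (@le_trans _ _ (\int[P]_w ((l / 2)%:E * (\1_(noise @^-1` A) w)%:E +
    (M / (2 * l))%:E * (likelihood (H *+ 2) w)%:E))).
  rewrite integral_mkcond; apply: ge0_le_integral => //=.
  - by move=> w _; apply: erestrict_ge0 => x _; rewrite lee_fin likelihood_ge0.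
  - by apply/(measurable_restrictT _ _).1 => //; exact: measurable_funTS.
  - apply: emeasurable_funD; apply: emeasurable_funM => //.
    by apply/measurable_EFinP; exact: measurable_indic.
  - move=> w _; rewrite -!EFinM -EFinD /patch indicE; case: ifPn => _.
      rewrite lee_fin mulr1 mulrAC -likelihood_sqr.
      set x := likelihood H w.
      have -> : (l / 2 + x ^+ 2 / (2 * l) = x + (x - l) ^+ 2 / (2 * l))%R.
        by field; rewrite gt_eqF.
      by rewrite lerDl divr_ge0 ?sqr_ge0// mulr_ge0// ltW.
    rewrite lee_fin mulr0 add0r mulr_ge0 ?likelihood_ge0//.
    by rewrite divr_ge0 ?expR_ge0// mulr_ge0// ltW.
rewrite ge0_integralD//=.
- rewrite ge0_integralZl//; last 2 first.
  + by apply/measurable_EFinP; exact: measurable_indic.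
  + by rewrite lee_fin divr_ge0// ltW.
  rewrite integral_indic// setIT ge0_integralZl//.
  + by rewrite integral_likelihood mule1.
  + by move=> w _; rewrite lee_fin likelihood_ge0.
  + by rewrite lee_fin divr_ge0 ?expR_ge0// mulr_ge0// ltW.
- by move=> w _; rewrite -EFinM lee_fin mulr_ge0// divr_ge0// ltW.
- by apply: emeasurable_funM => //; apply/measurable_EFinP; exact: measurable_indic.
- move=> w _; rewrite -EFinM lee_fin mulr_ge0 ?likelihood_ge0//.
  by rewrite divr_ge0 ?expR_ge0// mulr_ge0// ltW.
- exact: emeasurable_funM.
Qed.

(** The shift bound for [mu - nu], applied to the set of all [M] with [nu + M] in [A]. *)
Lemma noise_test_le (mu nu : 'M[R]_(n, m)) (l : R) (A : set (borel_mx R n m)) :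
    (0 < l)%R -> measurable A ->
  P [set w | A (mu + noise w)%R] <=
  (l / 2)%:E * P [set w | A (nu + noise w)%R]
    + (expR (mx_dot (mu - nu) (mu - nu) / s ^+ 2) / (2 * l))%:E.
Proof.
move=> l0 mA.
have mt : measurable_fun [set: borel_mx R n m]
    (fun M : borel_mx R n m => (nu + M)%R : borel_mx R n m).
  apply: measurable_mx => i j; under eq_fun do rewrite mxE.
  by apply: measurable_funD => //; exact: measurable_entry.
have := @noise_shift_le (mu - nu)%R l
  [set M : borel_mx R n m | A (nu + M)%R] l0.
rewrite (_ : [set w | _] = [set w | A (mu + noise w)%R]); last first.
  by apply/seteqP; split => w /=; rewrite addrA addrCA subrr addr0.
apply; rewrite -[X in measurable X]setTI; exact: mt.
Qed.

End gaussian_noise.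

(** * Product codes *)

Section assouad.
Local Open Scope ereal_scope.
Context (R : realType) (d : measure_display) (T : measurableType d)
  (P : probability T R) (n m : nat) (s : R) (E : 'I_n * 'I_m -> {RV P >-> R})
  (K J : finType).
Hypothesis s0 : (s != 0)%R.
Hypothesis gE : gaussian_noise s E.

Local Notation code := {ffun K -> J}.

Definition upd (t : code) (k : K) (j : J) : code :=
  [ffun i => if i == k then j else t i].

(* [(t, j) |-> (upd t k j, t k)] is an involution. *)
Lemma sum_upd (k : K) (F : code -> R) :
  (\sum_t \sum_j F (upd t k j) = #|J|%:R * \sum_t F t)%R.
Proof.
pose h (u : code * J) := (upd u.1 k u.2, u.1 k).
have hK : involutive h.
  move=> [t j]; rewrite /h/= ffunE eqxx; congr (_, _).
  by apply/ffunP => i; rewrite !ffunE; case: eqP => [->|].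
rewrite pair_big/= (reindex_inj (inv_inj hK))/=.
transitivity (\sum_(u : code * J) F u.1)%R.
  apply: eq_bigr => -[t j] _ /=; congr F.
  by apply/ffunP => i; rewrite !ffunE; case: eqP => [->|].
rewrite -(pair_big xpredT xpredT (fun t _ => F t))/= mulr_sumr.
by apply: eq_bigr => t _; rewrite sumr_const mulr_natl.
Qed.

Lemma measurable_fin_preimage d' (U : measurableType d') (F : finType)
    (f : U -> F) : (forall t, measurable (f @^-1` [set t])) ->
  forall Q : pred F, measurable [set u | Q (f u)].
Proof.
move=> mf Q.
rewrite (_ : [set u | _] = \bigcup_(t in [set t | Q t]) f @^-1` [set t]).
  by apply: fin_bigcup_measurable.
by apply/seteqP; split => [u Qu|u [t /= Qt ->]] //; exists (f u).
Qed.

Lemma sum_prob (I : finType) (A : I -> set T) :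
  (forall i, measurable (A i)) ->
  \sum_i P (A i) = \int[P]_w (\sum_i \1_(A i) w)%:E.
Proof.
move=> mA; under [RHS]eq_integral do rewrite -sumEFin.
rewrite ge0_integral_sum//=; last first.
  by move=> i; apply/measurable_EFinP; exact: measurable_indic.
by apply: eq_bigr => i _; rewrite integral_indic// setIT.
Qed.

(** * Error of a test, averaged over the codes *)

Section average_error.
Context (mu : code -> 'M[R]_(n, m)) (nu : K -> code -> 'M[R]_(n, m))
  (x : R) (test : borel_mx R n m -> code).
Hypothesis x0 : (0 < x)%R.
Hypothesis xJ : (x ^+ 4 = #|J|%:R)%R.
Hypothesis nuE : forall k t j, nu k (upd t k j) = nu k t.
Hypothesis mu_nu : forall k t,
  (expR (mx_dot (mu t - nu k t) (mu t - nu k t) / s ^+ 2) <= x ^+ 2)%R.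
Hypothesis mtest : forall Q : pred code,
  measurable [set M : borel_mx R n m | Q (test M)].

Let hit (a : 'M[R]_(n, m)) (k : K) (j : J) : R :=
  fine (P [set w | test (a + noise E w)%R k == j]).

Let hitE a k j :
  P [set w | test (a + noise E w)%R k == j] = (hit a k j)%:E.
Proof.
rewrite fineK// fin_num_measure//.
rewrite -[X in measurable X]setTI.
exact: (measurable_noise_shift _ _ measurableT (mtest (fun t => t k == j))).
Qed.

Let mhit a k j : measurable [set w | test (a + noise E w)%R k == j].
Proof.
rewrite -[X in measurable X]setTI.
exact: (measurable_noise_shift _ _ measurableT (mtest (fun t => t k == j))).
Qed.

Let hit_sum a k : (\sum_j hit a k j = 1)%R.
Proof.
apply: EFin_inj; rewrite -sumEFin.
under eq_bigr do rewrite -hitE.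
rewrite sum_prob => [|j]; last exact: mhit.
transitivity (\int[P]_(w in setT) cst 1 w); last first.
  by rewrite integral_cst// mul1e; exact: probability_setT.
apply: eq_integral => w _; congr (_%:E).
rewrite (bigD1 (test (a + noise E w)%R k))//= indicE mem_set//= big1 ?addr0//.
by move=> j jE; rewrite indicE memNset//=; apply/negP; rewrite eq_sym.
Qed.

(** The reference mean [nu k t] ignores coordinate [k] of [t], so under it the guess is right with
    average probability [1 / #|J| = x^-4]. Changing measure with [l = x ^+ 3] gives the average
    [(x^3 / 2) x^-4 + x^2 / (2 x^3) = 1 / x]. *)
Lemma sum_hit_le (k : K) :
  (\sum_t hit (mu t) k (t k) <= #|{: code}|%:R / x)%R.
Proof.
have le1 t : (hit (mu t) k (t k) <=
    x ^+ 3 / 2 * hit (nu k t) k (t k) + (2 * x)^-1)%R.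
  have l0 : (0 < x ^+ 3)%R by rewrite exprn_gt0.
  rewrite -lee_fin EFinD EFinM -!hitE.
  apply: le_trans (noise_test_le s0 gE (mu t) (nu k t) l0
    (mtest (fun u => u k == t k))) _.
  rewrite leeD2l// lee_fin ler_pdivrMr ?mulr_gt0//.
  apply: le_trans (mu_nu k t) _.
  by rewrite le_eqVlt; apply/orP; left; apply/eqP; field; rewrite gt_eqF.
apply: le_trans (ler_sum _ (fun t _ => le1 t)) _.
have sumc (c : R) : (\sum_(t : code) c = #|{: code}|%:R * c)%R.
  by rewrite sumr_const mulr_natl.
rewrite big_split/= sumc -mulr_sumr.
have J0 : (#|J|%:R != 0 :> R)%R by rewrite -xJ gt_eqF// exprn_gt0.
have -> : (\sum_t hit (nu k t) k (t k) = #|{: code}|%:R / #|J|%:R)%R.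
  apply: (mulfI J0); rewrite -(sum_upd k (fun t => hit (nu k t) k (t k))).
  rewrite mulrCA divff// -sumc; apply: eq_bigr => t _.
  rewrite -(hit_sum (nu k t) k); apply: eq_bigr => j _.
  by rewrite nuE ffunE eqxx.
rewrite -xJ.
by rewrite le_eqVlt; apply/orP; left; apply/eqP; field; rewrite gt_eqF.
Qed.

(** The bound holds on average over all codes, hence for at least one of them. *)
Lemma exists_sum_hit_le :
  exists t, (\sum_k P [set w | test (mu t + noise E w)%R k == t k]
    <= (#|K|%:R / x)%:E).
Proof.
have J0 : (0 < #|J|)%N by rewrite -(ltr_nat R) -xJ exprn_gt0.
have code0 : (0 < #|{: code}|)%N by rewrite card_ffun expn_gt0 J0.
apply: contrapT => /forallNP tN.
have : (\sum_(t : code) \sum_k hit (mu t) k (t k) > \sum_(t : code) #|K|%:R / x)%R.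
  apply: ltr_sum.
    by move/card_gt0P : code0 => [t _]; apply/hasP; exists t; rewrite ?mem_index_enum.
  move=> t _; have /negP := tN t; rewrite -ltNge.
  by under eq_bigr do rewrite hitE; rewrite sumEFin lte_fin.
rewrite exchange_big/=; apply/negP; rewrite -leNgt.
apply: le_trans (ler_sum _ (fun k _ => sum_hit_le k)) _.
have sumc (I : finType) (c : R) : (\sum_(i : I) c = #|I|%:R * c)%R.
  by rewrite sumr_const mulr_natl.
by rewrite !sumc mulrCA.
Qed.

(* Reverse Markov: the number of missed coordinates has mean at least
   [#|K| / 7] and never exceeds [#|K|]. *)
Lemma exists_error_prob : (0 < #|K|)%N -> (7 / 6 <= x)%R ->
  exists t, (13^-1)%:E <= P [set w |
    (#|K| <= 14 * #|[pred k | test (mu t + noise E w)%R k != t k]|)%N].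
Proof.
move=> K0 x76; have [t tP] := exists_sum_hit_le; exists t.
set Q := fun u : code => (#|K| <= 14 * #|[pred k | u k != t k]|)%N.
set G := [set w | _].
have mG : measurable G.
  rewrite -[X in measurable X]setTI.
  exact: (measurable_noise_shift _ _ measurableT (mtest Q)).
have K1 : (0 < #|K|%:R :> R)%R by rewrite ltr0n.
(* Outside [G] more than 13/14 of the coordinates are hit, while the expected number of hits is at
   most [#|K| / x <= (6 / 7) #|K|]; and (6/7) (14/13) = 12/13. *)
have GC : P (~` G) <= (12 / 13)%:E.
  have /(le_trans _) := tP.
  move=> /(_ (((13 / 14) * #|K|%:R)%:E * P (~` G))) h.
  rewrite -(@lee_pmul2l _ ((13 / 14) * #|K|%:R)%:E) ?lte_fin ?mulr_gt0//.
  apply: le_trans (h _) _.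
    rewrite sum_prob => [|k]; last exact: mhit.
    rewrite -[X in P X]setIT -integral_indic//; last exact: measurableC.
    rewrite -ge0_integralZl//=; last first.
      by apply/measurable_EFinP; apply: measurable_indic; exact: measurableC.
    apply: ge0_le_integral => //=.
    - apply: emeasurable_funM => //; apply/measurable_EFinP.
      by apply: measurable_indic; exact: measurableC.
    - apply/measurable_EFinP; apply: measurable_sum => k.
      by apply: measurable_indic; exact: mhit.
    - move=> w _; rewrite -EFinM lee_fin.
      set u := test (mu t + noise E w)%R.
      have -> : (\sum_k \1_[set w0 | test (mu t + noise E w0)%R k == t k] w =
          #|[pred k | u k == t k]|%:R :> R)%R.
        rewrite -sum1_card natr_sum [RHS]big_mkcond/=; apply: eq_bigr => k _.
        rewrite indicE inE; case: ifPn => ku; first by rewrite mem_set.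
        by rewrite memNset//=; apply/negP.
      have [wG|wG] := pselect (G w).
        by rewrite indicE memNset ?mulr0//; exact.
      rewrite indicE mem_set// mulr1.
      move: wG; rewrite /G/= -/u => /negP; rewrite -ltnNge => uK.
      have := cardC [pred k | u k == t k].
      rewrite (@eq_card _ (predC _) [pred k | u k != t k])// => cK.
      rewrite mulrAC ler_pdivrMr// -!natrM ler_nat.
      have aux (c e k : nat) :
          (14 * e < k -> c + e = k -> 13 * k <= c * 14)%N by lia.
      exact: aux uK cK.
  rewrite -EFinM lee_fin ler_pdivrMr//.
  by have := ler_wpM2l (ltW K1) x76; lra.
rewrite -[G]setCK probability_setC; last exact: measurableC.
have -> : (13^-1)%:E = 1 - (12 / 13 : R)%:E.
  by rewrite -EFinB; congr (_%:E); field.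
by rewrite leeB.
Qed.

End average_error.

End assouad.

(** * The Frobenius inner product *)

Section mx_dot_theory.
Context (R : realType) (a b : nat).
Implicit Types A B C : 'M[R]_(a, b).

Lemma mx_dotC A B : mx_dot A B = mx_dot B A.
Proof. by do 2 apply: eq_bigr => ? _; rewrite mulrC. Qed.

Lemma mx_dotDl A B C : mx_dot (A + B) C = mx_dot A C + mx_dot B C.
Proof.
rewrite -big_split/=; apply: eq_bigr => i _; rewrite -big_split/=.
by apply: eq_bigr => j _; rewrite mxE mulrDl.
Qed.

Lemma mx_dotZl (k : R) A B : mx_dot (k *: A) B = k * mx_dot A B.
Proof.
rewrite mulr_sumr; apply: eq_bigr => i _; rewrite mulr_sumr.
by apply: eq_bigr => j _; rewrite mxE mulrA.
Qed.

Lemma mx_dotDr A B C : mx_dot A (B + C) = mx_dot A B + mx_dot A C.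
Proof. by rewrite mx_dotC mx_dotDl !(mx_dotC A). Qed.

Lemma mx_dotZr (k : R) A B : mx_dot A (k *: B) = k * mx_dot A B.
Proof. by rewrite mx_dotC mx_dotZl mx_dotC. Qed.

Lemma mx_dotNl A B : mx_dot (- A) B = - mx_dot A B.
Proof. by rewrite -scaleN1r mx_dotZl mulN1r. Qed.

Lemma mx_dotNr A B : mx_dot A (- B) = - mx_dot A B.
Proof. by rewrite mx_dotC mx_dotNl mx_dotC. Qed.

Lemma mx_dot_suml (I : finType) (F : I -> 'M[R]_(a, b)) B :
  mx_dot (\sum_i F i) B = \sum_i mx_dot (F i) B.
Proof.
apply: (big_ind2 (fun A x => mx_dot A B = x)) => [|A x C y <- <-|//].
  by rewrite -(scale0r 0) mx_dotZl mul0r.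
exact: mx_dotDl.
Qed.

Lemma mx_dot_ge0 A : 0 <= mx_dot A A.
Proof. by do 2 apply: sumr_ge0 => ? _; rewrite -expr2 sqr_ge0. Qed.

(** Parallelogram law: entrywise the two sides differ by the square of [2 C - A - B]. *)
Lemma mx_dotB_le A B C :
  mx_dot (A - B) (A - B) <= 2 * (mx_dot (C - A) (C - A) + mx_dot (C - B) (C - B)).
Proof.
rewrite -!big_split/= mulr_sumr ler_sum// => i _.
rewrite -!big_split/= mulr_sumr ler_sum// => j _.
by rewrite !mxE -subr_ge0; have := sqr_ge0 (C i j *+ 2 - A i j - B i j); nra.
Qed.

Lemma mx_dot_sum_orth (I : finType) (F : I -> 'M[R]_(a, b)) :
    (forall i j, i != j -> mx_dot (F i) (F j) = 0) ->
  mx_dot (\sum_i F i) (\sum_i F i) = \sum_i mx_dot (F i) (F i).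
Proof.
move=> F0; rewrite mx_dot_suml; apply: eq_bigr => i _.
rewrite mx_dotC mx_dot_suml (bigD1 i)//= big1 ?addr0// => j ji.
exact: F0.
Qed.

Lemma loss_dot p (X : 'M[R]_(a, p)) (B : 'M[R]_(p, b)) (C : 'M[R]_(a, b)) :
  loss X B C = mx_dot (X *m B + C) (X *m B + C).
Proof.
rewrite /loss /frobenius sqr_sqrtr; last first.
  by do 2 apply: sumr_ge0 => ? _; rewrite sqr_ge0.
by do 2 apply: eq_bigr => ? _; rewrite expr2.
Qed.

Lemma measurable_mx_dot (d : measure_display) (T : measurableType d)
    (f : T -> borel_mx R a b) A : measurable_fun setT f ->
  measurable_fun setT (fun w => mx_dot (f w - A) (f w - A)).
Proof.
move=> mf; apply: measurable_sum => i; apply: measurable_sum => j.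
have mij : measurable_fun setT (fun w => (f w - A) i j).
  under eq_fun do rewrite !mxE.
  apply: measurable_funB => //.
  exact: (measurableT_comp (measurable_entry i j) mf).
exact: measurable_funM.
Qed.

End mx_dot_theory.

(** * Nearest-mean decoding and the loss on product codes *)

Section nearest.
Context (R : realType) (n m : nat) (F : finType) (t0 : F)
  (c : F -> 'M[R]_(n, m)) (Z : borel_mx R n m -> borel_mx R n m).
Hypothesis mZ : measurable_fun setT Z.

Let dist M t := mx_dot (Z M - c t) (Z M - c t).

(** A minimiser always exists in the finite type [F], so the default [t0] is never returned; [pick]
    settles ties. *)
Definition nearest (M : borel_mx R n m) : F :=
  odflt t0 [pick t | [forall u, dist M t <= dist M u]].

Lemma nearest_le M t : mx_dot (Z M - c (nearest M)) (Z M - c (nearest M)) <=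
  mx_dot (Z M - c t) (Z M - c t).
Proof.
rewrite /nearest; case: pickP => [u /forallP/(_ t)//|].
have [u _ uP] := @arg_minP _ R F t0 xpredT (dist M) isT.
move=> /(_ u)/negbT/negP; case; apply/forallP => v; exact: uP.
Qed.

(** The decoder depends on [M] only through a finite table of truth values, each a finite
    conjunction of comparisons of measurable functions. *)
Lemma measurable_nearest (Q : pred F) : measurable [set M | Q (nearest M)].
Proof.
pose table M : {ffun F -> bool} :=
  [ffun t => [forall u, dist M t <= dist M u]].
pose G (g : {ffun F -> bool}) := odflt t0 [pick t | g t].
have nE M : nearest M = G (table M).
  by congr odflt; apply: eq_pick => t; rewrite ffunE.
have mle t u : measurable [set M | dist M t <= dist M u].
  rewrite -[X in measurable X]setTI.
  by apply: measurable_fun_le => //; exact: measurable_mx_dot.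
have mtable t : measurable [set M | table M t].
  rewrite (_ : [set M | _] = \bigcap_(u in [set: F]) [set M | dist M t <= dist M u]).
    by apply: fin_bigcap_measurable.
  apply/seteqP; split => [M /=|M MP /=]; rewrite ffunE.
    by move=> /forallP MP u _; exact: MP.
  by apply/forallP => u; exact: MP.
rewrite (_ : [set M | _] = [set M | (Q \o G) (table M)]); last first.
  by apply/seteqP; split => M /=; rewrite nE.
apply: (@measurable_fin_preimage _ _ _ table) => g.
rewrite (_ : table @^-1` [set g] = \bigcap_(t in [set: F])
    (if g t then [set M | table M t] else ~` [set M | table M t])).
  apply: fin_bigcap_measurable => // t _.
  by case: ifP => _ //; exact: measurableC.
apply/seteqP; split => [M /= <- t _|M MP /=]; first by case: ifPn => // /negP.
apply/ffunP => t; have := MP t I; case: ifPn => //= gt.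
by move=> /negP/negbTE ->.
Qed.

End nearest.

Lemma product_code_lower_bound (R : realType) (d : measure_display)
    (T : measurableType d) (P : probability T R) (n m : nat) (s : R)
    (E : 'I_n * 'I_m -> {RV P >-> R}) (K : finType) (b : nat)
    (v : K -> 'I_b -> 'M[R]_(n, m)) (Z : borel_mx R n m -> borel_mx R n m) :
  0 < s -> gaussian_noise s E -> (0 < #|K|)%N -> (2 <= b)%N ->
  (forall k k' j j', k != k' -> mx_dot (v k j) (v k' j') = 0) ->
  (forall k j, mx_dot (v k j) (v k j) <= 1) ->
  (forall k j j', j != j' -> 1 <= mx_dot (v k j - v k j') (v k j - v k j')) ->
  measurable_fun setT Z ->
  exists t : {ffun K -> 'I_b}, exists2 A : set T,
    measurable A /\ ((13^-1)%:E <= P A)%E &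
    forall w, A w ->
      let mu := s * Num.sqrt (ln b%:R / 2) *: \sum_k v k (t k) in
      s ^+ 2 * (#|K|%:R * ln b%:R) / 112 <=
        mx_dot (Z (mu + noise E w) - mu) (Z (mu + noise E w) - mu).
Proof.
move=> s0 gE K0 b2 orth norm sep mZ.
set delta := s * _.
have b0 : 0 < b%:R :> R by rewrite ltr0n; lia.
have lnb0 : 0 <= ln b%:R :> R by rewrite ln_ge0// ler1n; lia.
have delta2 : delta ^+ 2 = s ^+ 2 * (ln b%:R / 2).
  by rewrite exprMn sqr_sqrtr// divr_ge0.
have sn0 : s != 0 by rewrite gt_eqF.
pose mu (t : {ffun K -> 'I_b}) := delta *: \sum_k v k (t k).
(* The reference for testing coordinate [k]: the mean [mu t] with component [k] erased. *)
pose nu k (t : {ffun K -> 'I_b}) := delta *: \sum_(i | i != k) v i (t i).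
pose t0 : {ffun K -> 'I_b} := [ffun=> Ordinal b2].
pose x : R := expR (ln b%:R / 4).
have x0 : 0 < x by exact: expR_gt0.
have x4 : x ^+ 4 = b%:R.
  rewrite -expRM_natl (_ : 4%:R * _ = ln b%:R) ?lnK ?posrE//.
  by field.
have x2 : x ^+ 2 = expR (ln b%:R / 2).
  by rewrite -expRM_natl; congr expR; field.
(* Since [x ^+ 4 = b] is at least 2 and (7/6)^4 < 2. *)
have x76 : 7 / 6 <= x.
  rewrite leNgt; apply/negP => x76.
  have : x ^+ 4 < (7 / 6) ^+ 4 by rewrite ltrXn2r// ltW.
  rewrite x4 => bx; have : 2 <= b%:R :> R by rewrite ler_nat.
  by move: bx; lra.
have nuE k t j : nu k (upd t k j) = nu k t.
  by congr (_ *: _); apply: eq_bigr => i /negbTE ik; rewrite ffunE ik.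
(* The difference is [delta *: v k (t k)], of squared norm at most [delta ^+ 2], so the exponent is
   at most [ln b / 2]. *)
have mu_nu k t :
    expR (mx_dot (mu t - nu k t) (mu t - nu k t) / s ^+ 2) <= x ^+ 2.
  rewrite -scalerBr (bigD1 k)//= addrK mx_dotZl mx_dotZr mulrA -expr2 delta2.
  rewrite x2 ler_expR ler_pdivrMr ?exprn_gt0// [leRHS]mulrC.
  by rewrite ler_piMr ?norm// mulr_ge0 ?sqr_ge0// divr_ge0.
pose test := nearest t0 mu Z.
have mtest := measurable_nearest t0 mu mZ.
have xJ : x ^+ 4 = #|'I_b|%:R by rewrite card_ord.
have [t tP] := exists_error_prob sn0 gE x0 xJ nuE mu_nu mtest K0 x76.
exists t; exists [set w |
    (#|K| <= 14 * #|[pred k | test (mu t + noise E w)%R k != t k]|)%N].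
  split=> //; rewrite -[X in measurable X]setTI.
  exact: (measurable_noise_shift _ _ measurableT (mtest
    (fun u => #|K| <= 14 * #|[pred k | u k != t k]|)%N)).
move=> w /=; rewrite -/(mu t); set M := mu t + noise E w; set u := test M => KH.
(* The decoded mean [mu u] is no farther from [Z M] than [mu t] is, so both terms of [mx_dotB_le]
   are at most the loss. *)
have le_dist : mx_dot (mu u - mu t) (mu u - mu t) <=
    4 * mx_dot (Z M - mu t) (Z M - mu t).
  apply: le_trans (mx_dotB_le _ _ (Z M)) _.
  have := nearest_le t0 mu Z M t; rewrite -/test -/u; lra.
(* By orthogonality squared distances add over coordinates, and each wrong one contributes at least
   [delta ^+ 2]. *)
have dist_ge : delta ^+ 2 * #|[pred k | u k != t k]|%:R <=
    mx_dot (mu u - mu t) (mu u - mu t).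
  rewrite -scalerBr -sumrB mx_dotZl mx_dotZr mulrA -expr2 ler_wpM2l ?sqr_ge0//.
  rewrite mx_dot_sum_orth => [|i j ij]; last first.
    rewrite mx_dotDl !mx_dotDr !mx_dotNl !mx_dotNr !orth//.
    by rewrite !oppr0 !addr0.
  rewrite -sum1_card natr_sum big_mkcond/=; apply: ler_sum => k _.
  by rewrite inE; case: ifPn => [/sep//|_]; exact: mx_dot_ge0.
have {}KH : #|K|%:R <= 14 * #|[pred k | u k != t k]|%:R :> R.
  by rewrite -natrM ler_nat.
(* The constant is 112 = 4 * 14 * 2: the factor in [le_dist], the fraction 1/14 of wrong
   coordinates, and the halved logarithm in [delta2]. *)
have := ler_wpM2l (sqr_ge0 delta) KH.
move: le_dist dist_ge; rewrite delta2.
set h := _%:R; set k := _%:R; set l := ln _.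
nra.
Qed.

(** Markov's inequality through the nondecreasing function [ell]. *)
Lemma risk_ge (R : realType) (d : measure_display) (T : measurableType d)
    (P : probability T R) (n p m : nat) (X : 'M[R]_(n, p))
    (E : 'I_n * 'I_m -> {RV P >-> R}) (ell : R -> R) (scale t : R)
    (D : ('M[R]_(n, m) -> 'M[R]_(p, m)) * ('M[R]_(n, m) -> 'M[R]_(n, m)))
    (BC : 'M[R]_(p, m) * 'M[R]_(n, m)) (A : set T) (a : R) :
  (forall x y : R, 0 <= x -> x <= y -> ell x <= ell y) -> ell 0 = 0 ->
  0 < scale -> 0 <= t -> measurable A -> (a%:E <= P A)%E ->
  (forall w, A w -> let Y := observation X E BC.1 BC.2 w in
     t * scale <= loss X (D.1 Y - BC.1) (D.2 Y - BC.2)) ->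
  ((ell t * a)%:E <= risk X E ell scale D BC)%E.
Proof.
move=> ell_mono ell0 scale0 t0 mA PA lossA.
have ell_ge0 x : 0 <= x -> 0 <= ell x by move=> x0; rewrite -ell0 ell_mono.
apply: (@le_trans _ _ (\int[P]_w (ell t * \1_A w)%:E)%E).
  under eq_integral do rewrite EFinM.
  rewrite ge0_integralZl ?lee_fin ?ell_ge0//; last first.
    by apply/measurable_EFinP; exact: measurable_indic.
  by rewrite integral_indic// setIT EFinM lee_wpmul2l// lee_fin ell_ge0.
have le_risk w : ell t * \1_A w <=
    ell (loss X (D.1 (observation X E BC.1 BC.2 w) - BC.1)
               (D.2 (observation X E BC.1 BC.2 w) - BC.2) / scale).
  have [wA|wA] := pselect (A w).
    rewrite indicE mem_set// mulr1 ell_mono// ler_pdivlMr//.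
    exact: lossA.
  by rewrite indicE memNset// mulr0 ell_ge0// divr_ge0 ?sqr_ge0// ltW.
have ell1 w : 0 <= ell t * \1_A w.
  by rewrite mulr_ge0 ?ell_ge0// indicE ler0n.
(* Integrals are compared as suprema over simple functions, so that measurability of the composed
   loss need not be established. *)
rewrite /risk unlock ge0_integralTE ?ge0_integralTE//.
- apply: le_ereal_sup => _ [h hA <-]; exists h => // w.
  by apply: le_trans (hA w) _; rewrite lee_fin.
- by move=> w; rewrite lee_fin (le_trans (ell1 w)).
Qed.

(** * The four subfamilies *)

(** Gram-Schmidt inside the column space of [X], recorded through the coefficients [W] so that the
    system can be realised as [X *m B]. *)
Lemma gram_schmidt (R : realType) (n p k : nat) (X : 'M[R]_(n, p)) :
  (k <= \rank X)%N ->
  exists W : 'M[R]_(p, k), (X *m W)^T *m (X *m W) = 1%:M.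
Proof.
elim: k => [|k IH] kX.
  by exists 0; apply/matrixP => -[].
have [W] := IH (ltnW kX); move LE : (X *m W) => L WL.
(* [X *m V] is the part of [X] orthogonal to the columns of [L]. If it vanished, [X] would factor
   through the [k] columns of [L], against [k < \rank X]. *)
pose V := 1%:M - W *m L^T *m X.
have XV : X *m V = X - L *m (L^T *m X).
  by rewrite mulmxBr mulmx1 -LE !mulmxA.
have [j [i Xij]] : exists j i, (X *m V) i j != 0.
  apply: contrapT => /forallNP X0.
  have /eqP : X = L *m (L^T *m X).
    apply/eqP; rewrite -subr_eq0 -XV; apply/eqP/matrixP => i j.
    by rewrite [RHS]mxE; apply/eqP; apply: contrapT => /negP h; apply: (X0 j); exists i.
  move=> /eqP XE; move: kX; rewrite XE ltnNge.
  by rewrite (leq_trans (mxrankM_maxl _ _)) ?rank_leq_col.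
pose w := col j V.
have Lw : L^T *m (X *m w) = 0.
  rewrite /w colE !mulmxA -(mulmxA _ X) XV mulmxBr !mulmxA WL mul1mx subrr.
  by rewrite mul0mx.
pose c := \sum_a (X *m w) a 0 ^+ 2.
have c0 : 0 < c.
  rewrite lt_neqAle sumr_ge0 ?andbT => [|a _]; last by rewrite sqr_ge0.
  rewrite eq_sym psumr_neq0 => [|a _]; last by rewrite sqr_ge0.
  apply/hasP; exists i; rewrite ?mem_index_enum//=.
  by rewrite lt_neqAle sqr_ge0 eq_sym sqrf_eq0 andbT /w colE mulmxA -colE mxE.
have ww : (X *m w)^T *m (X *m w) = c%:M.
  apply/matrixP => a b; rewrite !ord1 !mxE eqxx mulr1n.
  by apply: eq_bigr => e _; rewrite mxE expr2.
have [y yE] : {y | y = (Num.sqrt c)^-1 *: (X *m w)} by eexists.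
have Ly : L^T *m y = 0 by rewrite yE -scalemxAr Lw scaler0.
have yL : y^T *m L = 0.
  by rewrite -[L]trmxK -trmx_mul Ly trmx0.
have yy : y^T *m y = 1%:M.
  rewrite yE -scalemxAr [(_ *: _)^T]linearZ/= -scalemxAl ww scalerA -expr2 exprVn.
  by rewrite sqr_sqrtr ?ltW// scale_scalar_mx mulVf// gt_eqF.
(* The size [1 + k], convertible to [k.+1], matches the block [row_mx] that prepends the new
   vector. *)
suff : exists U : 'M[R]_(p, 1 + k), (X *m U)^T *m (X *m U) = 1%:M by [].
exists (row_mx ((Num.sqrt c)^-1 *: w) W).
rewrite mul_mx_row LE -scalemxAr -yE tr_row_mx mul_col_row.
by rewrite yy WL Ly yL scalar_mx_block.
Qed.

Section rank_one_family.
Context (R : realType) (n m a c : nat) (L : 'M[R]_(n, a)) (Q : 'M[R]_(c, m)).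
Hypothesis LL : L^T *m L = 1%:M.
Hypothesis QQ : Q *m Q^T = 1%:M.

(** One bit of a binary code: letter 0 is the zero matrix, letter 1 a unit matrix of rank one. *)
Definition rank_one (k : 'I_a * 'I_c) (s : 'I_2) : 'M[R]_(n, m) :=
  (s != ord0)%:R *: (col k.1 L *m row k.2 Q).

(** The inner product factors into an entry of the Gram matrix of [L] and one of that of [Q], both
    identities. *)
Lemma mx_dot_rank_one (k k' : 'I_a * 'I_c) :
  mx_dot (col k.1 L *m row k.2 Q) (col k'.1 L *m row k'.2 Q) = (k == k')%:R.
Proof.
have E i j x y : (col i L *m row j Q) x y = L x i * Q j y.
  by rewrite mxE big_ord1 !mxE.
transitivity ((L^T *m L) k.1 k'.1 * (Q *m Q^T) k.2 k'.2).
  rewrite !mxE mulr_suml; apply: eq_bigr => x _.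
  rewrite mulr_sumr; apply: eq_bigr => y _.
  by rewrite !E !mxE mulrACA.
rewrite LL QQ !mxE -natrM mulnb.
by case: k k' => [i j] [i' j'].
Qed.

Lemma rank_one_orth k k' s s' : k != k' ->
  mx_dot (rank_one k s) (rank_one k' s') = 0.
Proof.
by move=> /negbTE kk; rewrite mx_dotZl mx_dotZr mx_dot_rank_one kk !mulr0.
Qed.

Lemma rank_one_norm k s : mx_dot (rank_one k s) (rank_one k s) <= 1.
Proof.
rewrite mx_dotZl mx_dotZr mx_dot_rank_one eqxx mulr1.
by case: (_ != _); rewrite ?mulr1 ?mulr0 ?ler01.
Qed.

Lemma rank_one_sep k s s' : s != s' ->
  1 <= mx_dot (rank_one k s - rank_one k s') (rank_one k s - rank_one k s').
Proof.
move=> ss'; rewrite -scalerBl mx_dotZl mx_dotZr mx_dot_rank_one eqxx mulr1.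
suff -> : ((s != ord0)%:R - (s' != ord0)%:R) *
          ((s != ord0)%:R - (s' != ord0)%:R) = 1 :> R by [].
case: s s' ss' => -[|[|//]] ? [[|[|//]] ?] //= _.
  by rewrite sub0r mulrNN mulr1.
by rewrite subr0 mulr1.
Qed.

(** Writes a codeword as a product, from which the rank or row-sparsity constraint can be read
    off. *)
Lemma sum_rank_one (t : {ffun 'I_a * 'I_c -> 'I_2}) :
  \sum_k rank_one k (t k) = L *m (\matrix_(i, j) (t (i, j) != ord0)%:R) *m Q.
Proof.
apply/matrixP => x y; rewrite summxE !mxE.
under [RHS]eq_bigr do rewrite !mxE mulr_suml.
rewrite exchange_big pair_big/=; apply: eq_bigr => -[i j] _ /=.
by rewrite !mxE big_ord1 !mxE mulrCA mulrA.
Qed.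

End rank_one_family.

Section sparse_family.
Context (R : realType) (n m J b : nat) (j0 : 'I_m).
Hypothesis Jbn : (J * b <= n)%N.

Lemma block_index_lt (k : 'I_J) (j : 'I_b) : (k * b + j < n)%N.
Proof. have := ltn_ord k; have := ltn_ord j; nia. Qed.

(** Row [j] of block [k], the blocks being consecutive runs of [b] rows. *)
Definition block_index (k : 'I_J) (j : 'I_b) : 'I_n :=
  Ordinal (block_index_lt k j).

Lemma block_index_inj k k' j j' :
  (block_index k j == block_index k' j') = (k == k') && (j == j').
Proof.
apply/eqP/andP => [/(congr1 val)/= kj|[/eqP-> /eqP->]//].
have b0 : (0 < b)%N by apply: leq_trans (ltn_ord j).
have kk : k = k' :> nat.
  have := congr1 (divn^~ b) kj.
  by rewrite /= !divnMDl// !divn_small// !addn0.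
have jj : j = j' :> nat by move: kj; rewrite kk => /addnI.
by split; apply/eqP/val_inj.
Qed.

Definition one_hot (k : 'I_J) (j : 'I_b) : 'M[R]_(n, m) :=
  delta_mx (block_index k j) j0.

Lemma mx_dot_one_hot k k' j j' :
  mx_dot (one_hot k j) (one_hot k' j') = ((k == k') && (j == j'))%:R.
Proof.
rewrite -block_index_inj /mx_dot (bigD1 (block_index k j))//=.
rewrite [X in _ + X]big1 => [|i ik]; last first.
  by apply: big1 => i' _; rewrite mxE (negbTE ik) mul0r.
rewrite (bigD1 j0)//= big1 => [|i ij]; last first.
  by rewrite mxE (negbTE ij) andbF mul0r.
by rewrite !mxE !eqxx/= andbT !addr0 mul1r.
Qed.

Lemma one_hot_sep k j j' : j != j' ->
  1 <= mx_dot (one_hot k j - one_hot k j') (one_hot k j - one_hot k j').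
Proof.
move=> jj; rewrite mx_dotDl !mx_dotDr !mx_dotNl !mx_dotNr !mx_dot_one_hot.
rewrite !eqxx/= (eq_sym j') (negbTE jj)/= mulr0n mulr1n; lra.
Qed.

(** Nonzero rows lie in the image of the [J] blocks under the choice of spike. *)
Lemma row_sparsity_one_hot (a : R) (t : {ffun 'I_J -> 'I_b}) :
  (row_sparsity (a *: \sum_k one_hot k (t k)) <= J)%N.
Proof.
rewrite -[leqRHS]card_ord -cardsT.
apply: leq_trans (leq_imset_card (fun k => block_index k (t k)) _).
apply/subset_leq_card/fintype.subsetP => i; rewrite inE; apply: contraR => iN.
apply/eqP/rowP => j; rewrite !mxE summxE big1 ?mulr0// => k _.
rewrite mxE; case: eqP => // ik; move: iN; rewrite ik => /negP; case.
exact: imset_f.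
Qed.

End sparse_family.

(** * From product codes to the worst-case risk *)

Lemma code_risk_bound (R : realType) (ell : R -> R) (t s scale : R)
    (n p m r J : nat) (X : 'M[R]_(n, p)) (d : measure_display)
    (T : measurableType d) (P : probability T R)
    (E : 'I_n * 'I_m -> {RV P >-> R}) (K : finType) (b : nat)
    (v : K -> 'I_b -> 'M[R]_(n, m))
    (B : {ffun K -> 'I_b} -> 'M[R]_(p, m))
    (C : {ffun K -> 'I_b} -> 'M[R]_(n, m))
    (D : ('M[R]_(n, m) -> 'M[R]_(p, m)) * ('M[R]_(n, m) -> 'M[R]_(n, m))) :
  (forall x y : R, 0 <= x -> x <= y -> ell x <= ell y) -> ell 0 = 0 ->
  0 <= t -> 0 < s -> 0 < scale -> gaussian_noise s E ->
  (0 < #|K|)%N -> (2 <= b)%N ->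
  (forall k k' j j', k != k' -> mx_dot (v k j) (v k' j') = 0) ->
  (forall k j, mx_dot (v k j) (v k j) <= 1) ->
  (forall k j j', j != j' -> 1 <= mx_dot (v k j - v k j') (v k j - v k j')) ->
  (forall u, param_space r J (B u, C u)) ->
  (forall u, X *m B u + C u =
     s * Num.sqrt (ln b%:R / 2) *: \sum_k v k (u k)) ->
  t * scale <= s ^+ 2 * (#|K|%:R * ln b%:R) / 112 ->
  estimator D ->
  ((ell t * 13^-1)%:E <=
    ereal_sup [set risk X E ell scale D BC | BC in @param_space R n p m r J])%E.
Proof.
move=> ell_mono ell0 t0 s0 scale0 gE K0 b2 orth norm sep BC_param BCE t_le [mD1 mD2].
(* The loss sees the estimator only through the mean it predicts. *)
pose Z (M : borel_mx R n m) : borel_mx R n m := X *m D.1 M + D.2 M.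
have mZ : measurable_fun setT Z.
  apply: measurable_mx => i j.
  under eq_fun do rewrite !mxE.
  apply: measurable_funD.
    apply: measurable_sum => k; apply: measurable_funM => //.
    exact: (measurableT_comp (measurable_entry k j) mD1).
  exact: (measurableT_comp (measurable_entry i j) mD2).
have [u [A [mA PA] Au]] :=
  product_code_lower_bound s0 gE K0 b2 orth norm sep mZ.
apply: le_trans (ereal_sup_ubound _) => /=; last first.
  by exists (B u, C u); [exact: BC_param|reflexivity].
apply: risk_ge mA PA _ => // w Aw /=; apply: le_trans t_le _.
rewrite loss_dot /observation/= BCE.
rewrite mulmxBr addrACA -opprD BCE.
exact: Au.
Qed.

(** * Size of the rate [P_o] *)

Lemma ln2_ge_half (R : realType) : 2^-1 <= ln 2 :> R.
Proof.
have := @le_ln1Dx R (- 2^-1); rewrite (_ : 1 + - 2^-1 = 2^-1 :> R); last by field.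
by rewrite lnV ?posrE//; lra.
Qed.

Lemma P_o_gt0 (R : realType) (s : R) (n m q J r : nat) :
  0 < s -> (0 < J)%N -> (J <= n)%N -> (0 < r)%N -> (0 < m)%N ->
  0 < P_o s n m q J r.
Proof.
move=> s0 J0 Jn r0 m0; rewrite mulr_gt0 ?exprn_gt0// ltr_wpDr//.
  rewrite mulr_ge0// ln_ge0// ler_pdivlMr ?ltr0n// mul1r.
  by rewrite (@le_trans _ _ n%:R) ?ler_nat// ler_peMl// -[leLHS]expR0 ler_expR.
by rewrite ltr_wpDr// ltr0n muln_gt0 r0 addn_gt0 m0 orbT.
Qed.

(** With [b = n %/ J >= 2], [n / J < b + 1 <= b ^ 2], so the logarithm is at most [1 + 2 ln b]. The
    leftover [J] is absorbed into a second copy of [J * m]. *)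
Lemma P_o_le (R : realType) (s : R) (n m q J r : nat) : (0 < J)%N ->
  (2 * J <= n)%N -> (0 < m)%N ->
  P_o s n m q J r <= s ^+ 2 * ((q * r)%:R + (r * m)%:R + 2 * (J * m)%:R
                               + 2 * (J%:R * ln (n %/ J)%:R)).
Proof.
move=> J0 Jn m0; rewrite ler_wpM2l ?sqr_ge0//.
have JR : 0 < J%:R :> R by rewrite ltr0n.
have b2 : (2 <= n %/ J)%N by rewrite leq_divRL.
have nb : n%:R / J%:R <= (n %/ J)%:R ^+ 2 :> R.
  rewrite ler_pdivrMr// -natrX -natrM ler_nat.
  have := divn_eq n J; have := ltn_pmod n J0; nia.
have n0 : 0 < n%:R :> R by rewrite ltr0n; lia.
have lnE : ln (expR 1 * n%:R / J%:R) <= 1 + 2 * ln (n %/ J)%:R :> R.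
  rewrite -mulrA lnM ?posrE ?expR_gt0 ?divr_gt0// expRK lerD2l.
  have b0 : 0 < (n %/ J)%:R :> R by rewrite ltr0n; lia.
  by rewrite [leRHS]mulr_natl -lnXn// ler_ln ?posrE ?divr_gt0 ?exprn_gt0.
have := ler_wpM2l (ltW JR) lnE.
have : J%:R <= (J * m)%:R :> R by rewrite ler_nat leq_pmulr.
rewrite mulnDr !natrD (mulnC r q); lra.
Qed.

Lemma row_sparsity_pid (R : realType) (n m J : nat) (M : 'M[R]_(J, m)) :
  (J <= n)%N -> (row_sparsity ((pid_mx J : 'M[R]_(n, J)) *m M) <= J)%N.
Proof.
move=> Jn; rewrite -[leqRHS]card_ord -cardsT.
apply: leq_trans (leq_imset_card (widen_ord Jn) _).
apply/subset_leq_card/fintype.subsetP => i; rewrite inE; apply: contraR => iN.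
apply/eqP/rowP => j; rewrite !mxE big1// => k _; rewrite mxE.
case: eqP => [ik|]; last by rewrite mul0r.
move: iN; rewrite (_ : i = widen_ord Jn k); last exact: val_inj.
by rewrite imset_f.
Qed.

(** * Choice of the subfamily by the dominant term *)

Theorem theorem5 (R : realType) (ell : R -> R)
    (ell_mono : forall x y : R, 0 <= x -> x <= y -> ell x <= ell y)
    (ell0 : ell 0 = 0)
    (ell_neq0 : exists2 t : R, 0 <= t & ell t != 0) :
  exists ct c : R, [/\ 0 < ct, 0 < c &
    forall (kappa : R) (n p m r J : nat) (sigma : R) (X : 'M[R]_(n, p))
      (d : measure_display) (T : measurableType d) (P : probability T R)
      (E : 'I_n * 'I_m -> {RV P >-> R}),
    0 < kappa ->
    0 < sigma ->
    (2 <= n)%N ->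
    (1 <= J)%N ->
    J%:R <= n%:R / 2 :> R ->
    (1 <= r <= minn (\rank X) m)%N ->
    (8 <= r * (\rank X + m - r))%N ->
    kappa <= sigma_min X / sigma_max X ->
    gaussian_noise sigma E ->
    (c%:E <=
      ereal_inf [set
        ereal_sup [set risk X E ell (ct * P_o sigma n m (\rank X) J r)%R D BC
          | BC in @param_space R n p m r J]
        | D in @estimator R n p m])%E].
Proof.
have [t t0 ellt] := ell_neq0.
have t_gt0 : 0 < t.
  by rewrite lt_neqAle t0 andbT; apply: contraNneq ellt => <-; rewrite ell0.
have ellt_gt0 : 0 < ell t.
  by rewrite lt_neqAle eq_sym ellt -ell0 ell_mono.
(* 1344 = 112 * 12: the loss constant of a code times the factor allowed in [t_le]. The numeral is
   hidden behind [N] to keep it opaque. *)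
have : 0 < 1344 :> R by rewrite ltr0n.
move NE : (1344 : R) => N N0.
exists (N * t)^-1, (ell t * 13^-1); split; rewrite ?invr_gt0 ?mulr_gt0//.
move=> kappa n p m r J s X d T P E _ s0 _ J1 Jn /andP[r1 rqm] _ _ gE.
move: rqm; rewrite leq_min; set q := \rank X => /andP[rq rm].
have {}Jn : (2 * J <= n)%N.
  by rewrite -(ler_nat R) natrM mulrC -ler_pdivlMr.
have JleN : (J <= n)%N by rewrite (leq_trans _ Jn)// leq_pmull.
have m0 : (0 < m)%N by exact: leq_trans rm.
have q0 : (0 < q)%N by exact: leq_trans rq.
have b2 : (2 <= n %/ J)%N by rewrite leq_divRL.
have s20 : 0 < s ^+ 2 by rewrite exprn_gt0.
pose S := P_o s n m q J r / s ^+ 2.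
have PoE : P_o s n m q J r = s ^+ 2 * S by rewrite mulrC divfK// gt_eqF.
have S_le : S <= (q * r)%:R + (r * m)%:R + 2 * (J * m)%:R
    + 2 * (J%:R * ln (n %/ J)%:R).
  by rewrite ler_pdivrMr// mulrC P_o_le.
have Po0 : 0 < P_o s n m q J r by apply: P_o_gt0.
have scale0 : 0 < (N * t)^-1 * P_o s n m q J r.
  by apply: mulr_gt0 => //; rewrite invr_gt0 mulr_gt0.
have t_scale : t * ((N * t)^-1 * P_o s n m q J r) = s ^+ 2 * (S / N).
  by rewrite PoE; field; rewrite (gt_eqF N0) (gt_eqF t_gt0).
have t_le (k b : nat) : S <= 6 * (k%:R * (2 * ln b%:R)) ->
    t * ((N * t)^-1 * P_o s n m q J r) <= s ^+ 2 * (k%:R * ln b%:R) / 112.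
  move=> Sk; rewrite t_scale -mulrA ler_wpM2l ?sqr_ge0// -NE; lra.
apply: le_ereal_inf_tmp => _ [D mD <-].
(* For binary codes, [2 ln 2 >= 1] lets the number of bits stand for the entropy. *)
have two_ln2 (k : nat) : S <= 6 * k%:R -> S <= 6 * (k%:R * (2 * ln 2%:R)).
  move=> /le_trans; apply; rewrite ler_wpM2l// ler_peMr//.
  by have := ln2_ge_half R; lra.
have lnb0 : 0 <= J%:R * ln (n %/ J)%:R :> R.
  by rewrite mulr_ge0// ln_ge0// ler1n; lia.
(* The weights 1, 1, 2, 2 in [S_le] sum to 6, so one of the four quantities is at least [S / 6].
   Here it is [q * r]: a full orthonormal basis of the column space is used, and the rank is at most
   [r] because [Q] has [r] rows. *)
have [S1|S1] := lerP S (6 * (q * r)%:R).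
  have [W WW] := gram_schmidt (leqnn (\rank X)).
  pose Q : 'M[R]_(r, m) := pid_mx r.
  have QQ : Q *m Q^T = 1%:M.
    by rewrite tr_pid_mx pid_mx_id// pid_mx_1.
  pose Th (u : {ffun 'I_q * 'I_r -> 'I_2}) : 'M[R]_(q, r) :=
    \matrix_(i, j) (u (i, j) != ord0)%:R.
  apply: (@code_risk_bound R ell t s _ n p m r J X d T P E _ 2
    (rank_one (X *m W) Q)
    (fun u => s * Num.sqrt (ln 2%:R / 2) *: (W *m Th u *m Q)) (fun=> 0)) => //.
  - by rewrite card_prod !card_ord muln_gt0 q0.
  - by move=> *; exact: rank_one_orth.
  - by move=> *; exact: rank_one_norm.
  - by move=> *; exact: rank_one_sep.
  - move=> u; split => /=.
      rewrite (leq_trans (mxrank_scale _ _))// (leq_trans (mxrankM_maxr _ _))//.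
      exact: rank_leq_row.
    rewrite /row_sparsity (_ : [set i | _]%SET = finset.set0) ?cards0//.
    by apply/setP => i; rewrite !inE row0 eqxx.
  - by move=> u; rewrite addr0 -scalemxAr sum_rank_one !mulmxA.
  - apply: t_le; rewrite card_prod !card_ord; exact: two_ln2.
(* Only [r] orthonormal vectors are used, so [W] has [r] columns and all [m] response columns are
   free. *)
have [S2|S2] := lerP S (6 * (r * m)%:R).
  have [W WW] := gram_schmidt rq.
  pose Th (u : {ffun 'I_r * 'I_m -> 'I_2}) : 'M[R]_(r, m) :=
    \matrix_(i, j) (u (i, j) != ord0)%:R.
  have QQ : 1%:M *m (1%:M)^T = 1%:M :> 'M[R]_m by rewrite mul1mx trmx1.
  apply: (@code_risk_bound R ell t s _ n p m r J X d T P E _ 2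
    (rank_one (X *m W) 1%:M)
    (fun u => s * Num.sqrt (ln 2%:R / 2) *: (W *m Th u)) (fun=> 0)) => //.
  - by rewrite card_prod !card_ord muln_gt0 r1.
  - by move=> *; exact: rank_one_orth.
  - by move=> *; exact: rank_one_norm.
  - by move=> *; exact: rank_one_sep.
  - move=> u; split => /=.
      rewrite (leq_trans (mxrank_scale _ _))// (leq_trans (mxrankM_maxl _ _))//.
      exact: rank_leq_col.
    rewrite /row_sparsity (_ : [set i | _]%SET = finset.set0) ?cards0//.
    by apply/setP => i; rewrite !inE row0 eqxx.
  - by move=> u; rewrite addr0 -scalemxAr sum_rank_one !mulmxA mulmx1.
  - apply: t_le; rewrite card_prod !card_ord; exact: two_ln2.
(* Here [B = 0], and the bits fill the first [J] rows of [C]. *)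
have [S3|S3] := lerP S (6 * (J * m)%:R).
  pose L : 'M[R]_(n, J) := pid_mx J.
  have LL : L^T *m L = 1%:M.
    by rewrite tr_pid_mx pid_mx_id ?pid_mx_1.
  pose Th (u : {ffun 'I_J * 'I_m -> 'I_2}) : 'M[R]_(J, m) :=
    \matrix_(i, j) (u (i, j) != ord0)%:R.
  have QQ : 1%:M *m (1%:M)^T = 1%:M :> 'M[R]_m by rewrite mul1mx trmx1.
  apply: (@code_risk_bound R ell t s _ n p m r J X d T P E _ 2
    (rank_one L 1%:M) (fun=> 0)
    (fun u => s * Num.sqrt (ln 2%:R / 2) *: (L *m Th u))) => //.
  - by rewrite card_prod !card_ord muln_gt0 J1.
  - by move=> *; exact: rank_one_orth.
  - by move=> *; exact: rank_one_norm.
  - by move=> *; exact: rank_one_sep.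
  - move=> u; split => /=; first by rewrite mxrank0.
    rewrite scalemxAr; exact: row_sparsity_pid.
  - by move=> u; rewrite mulmx0 add0r sum_rank_one mulmx1.
  - apply: t_le; rewrite card_prod !card_ord; exact: two_ln2.
(* Otherwise the logarithmic term dominates: [J] coordinates over an alphabet of size [n %/ J]. *)
have Jbn : (J * (n %/ J) <= n)%N by rewrite mulnC leq_trunc_div.
apply: (@code_risk_bound R ell t s _ n p m r J X d T P E _ (n %/ J)
  (one_hot R (Ordinal m0) Jbn) (fun=> 0)
  (fun u => s * Num.sqrt (ln (n %/ J)%:R / 2) *:
     \sum_k one_hot R (Ordinal m0) Jbn k (u k))) => //.
- by rewrite card_ord.
- by move=> k k' j j' kk; rewrite mx_dot_one_hot (negbTE kk).
- by move=> k j; rewrite mx_dot_one_hot !eqxx.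
- by move=> *; exact: one_hot_sep.
- by move=> u; split => /=; [rewrite mxrank0|exact: row_sparsity_one_hot].
- by move=> u; rewrite mulmx0 add0r.
- by apply: t_le; rewrite card_ord; lra.
Qed.
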